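(* For every positive integer $d$ and every integer $k\in\{1,\dots,d+1\}$, \[\alpha_{d,k}+\beta_{d+1,k}=1.\]
   Context: For a finite family $\mathcal{F}$ of convex sets in $\mathbb{R}^d$ and $p\in\mathbb{R}^d$, $\operatorname{dep}_\mathcal{F}(p)$ is the smallest number of sets of $\mathcal{F}$ intersected by a closed halfspace containing $p$. A family is $k$-intersecting if every subfamily of at most $k$ of its members has nonempty intersection. For integers $1\le k\le d+1$, $\alpha_{d,k}$ is the largest real number such that every finite $k$-intersecting family $\mathcal{F}$ of convex sets in $\mathbb{R}^d$ has a point $p$ with $\operatorname{dep}_\mathcal{F}(p)\ge\alpha_{d,k}|\mathcal{F}|$. For a family of subsets of a set $X$, a hitting set is a subset $Y\subseteq X$ meeting every member of the family. For a positive integer $m$ and $k\in\{1,\dots,m\}$, $\beta_{m,k}$ is the smallest real number $\beta$ such that: for any finite set $X$ and any $m$ subsets $A_1,\dots,A_m$ of $X$ with $|A_i|>\beta|X|$ for all $i$, there is a hitting set for $\{A_1,\dots,A_m\}$ of size at most $k$. *)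

(* Defs.v *)
From mathcomp Require Import all_boot all_order all_algebra.
From mathcomp Require Import boolp classical_sets reals topology convex.

Set Implicit Arguments.
Unset Strict Implicit.
Unset Printing Implicit Defensive.

Import Order.TTheory GRing.Theory Num.Theory.
Local Open Scope classical_set_scope.
Local Open Scope ring_scope.

Section Families.
Context {R : realType} {d : nat}.

Definition closed_halfspace (H : set 'rV[R]_d) : Prop :=
  exists (u : 'rV[R]_d) (c : R),
    u != 0 /\ H = [set x : 'rV[R]_d | c <= \sum_(j < d) u 0 j * x 0 j].

(* Families are indexed by a finite type: repetitions are allowed and counted
   with multiplicity. *)
Context {I : finType}.
Implicit Types (F : I -> set 'rV[R]_d) (H : set 'rV[R]_d) (p : 'rV[R]_d).

Definition hits F H : {set I} := [set i | `[< F i `&` H !=set0 >]].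

(* The minimum is taken over all J of the form [hits F H]. The starting value
   #|I| is an upper bound of all the #|J|, so it only matters for d = 0, where
   there is no halfspace; see [dep_smallest]. *)
Definition dep F p : nat :=
  \big[minn/#|I|]_(J : {set I} |
      `[< exists H, [/\ closed_halfspace H, H p & J = hits F H] >]) #|J|.

Definition k_intersecting (k : nat) F : Prop :=
  forall J : {set I}, (#|J| <= k)%N -> \bigcap_(i in [set` J]) F i !=set0.

End Families.

Definition depth_bounds (R : realType) (d k : nat) : set R :=
  [set a | forall (I : finType) (F : I -> set 'rV[R]_d),
     (forall i, convex_set (F i)) -> k_intersecting k F ->
     exists p, a * #|I|%:R <= (dep F p)%:R].

(* The supremum is a maximum; see [alpha_largest]. *)
Definition alpha (R : realType) (d k : nat) : R := sup (@depth_bounds R d k).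

Definition hitting_set (X : finType) (m : nat) (A : 'I_m -> {set X})
  (Y : {set X}) : Prop := forall i, exists2 x, x \in Y & x \in A i.

Definition hitting_bounds (R : realType) (m k : nat) : set R :=
  [set b | forall (X : finType) (A : 'I_m -> {set X}),
     (forall i, b * #|X|%:R < #|A i|%:R) ->
     exists Y : {set X}, hitting_set A Y /\ (#|Y| <= k)%N].

(* The infimum is a minimum; see [beta_smallest]. *)
Definition beta (R : realType) (m k : nat) : R := inf (@hitting_bounds R m k).

Lemma dep_smallest (R : realType) (d : nat) (I : finType)
    (F : I -> set 'rV[R]_d) (p : 'rV[R]_d) : (0 < d)%N ->
  (exists H, [/\ closed_halfspace H, H p & dep F p = #|hits F H| ]) /\
  (forall H, closed_halfspace H -> H p -> (dep F p <= #|hits F H|)%N).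
Proof.
move=> d0.
have le_dep H : closed_halfspace H -> H p -> (dep F p <= #|hits F H|)%N.
  move=> hH Hp; rewrite /dep -minEnat -leEnat; apply: bigmin_le_cond.
  by apply/asboolP; exists H.
split=> //.
have : dep F p = #|I| \/
    exists H, [/\ closed_halfspace H, H p & dep F p = #|hits F H| ].
  rewrite {1 2}/dep.
  elim/big_ind : _ => [|x y hx hy|J /asboolP[H [hH Hp ->]]]; first by left.
    by rewrite /minn; case: ifP.
  by right; exists H.
case=> // depE.
pose u : 'rV[R]_d := delta_mx 0 (Ordinal d0).
pose c := \sum_(j < d) u 0 j * p 0 j.
pose H0 := [set x : 'rV[R]_d | c <= \sum_(j < d) u 0 j * x 0 j].
have hH0 : closed_halfspace H0.
  exists u, c; split=> //; apply/eqP => /matrixP/(_ 0 (Ordinal d0)).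
  by rewrite !mxE !eqxx => /eqP; rewrite oner_eq0.
have H0p : H0 p by exact: lexx.
exists H0; split=> //; apply/eqP; rewrite eqn_leq le_dep //=.
by rewrite depE max_card.
Qed.

Lemma alpha_largest (R : realType) (d k : nat) :
  (0 < d)%N -> (0 < k)%N ->
  depth_bounds d k (alpha R d k) /\ ubound (depth_bounds d k) (alpha R d k).
Proof.
move=> d0 k0.
have dep_le (I : finType) (F : I -> set 'rV[R]_d) p : (dep F p <= #|I|)%N.
  have [[H [_ _ ->]] _] := dep_smallest F p d0; exact: max_card.
have S0 : @depth_bounds R d k 0.
  by move=> I F _ _; exists 0; rewrite mul0r.
have S1 : ubound (@depth_bounds R d k) 1.
  move=> a /(_ unit (fun=> setT)) [|| p].
  - by move=> _ x y l _ _; rewrite inE.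
  - by move=> J _; exists 0.
  rewrite card_unit mulr1 => /le_trans; apply.
  by rewrite lern1 (leq_trans (dep_le _ _ _)) ?card_unit.
have hS : has_sup (@depth_bounds R d k) by split; [exists 0 | exists 1].
split; last exact: sup_upper_bound.
move=> I F cF kF.
have [I0|I0] := posnP #|I|.
  by exists 0; rewrite I0 mulr0.
pose P n := `[< exists p, dep F p = n >].
have exP : exists n, P n by exists (dep F 0); apply/asboolP; exists 0.
have bP n : P n -> (n <= #|I|)%N by case/asboolP => p <-.
case: (ex_maxnP exP bP) => n /asboolP[p pn] nmax.
exists p; rewrite -ler_pdivlMr ?ltr0n //.
apply: ge_sup => [|a /(_ I F cF kF) [q hq]]; first by exists 0.
rewrite ler_pdivlMr ?ltr0n // (le_trans hq) // ler_nat pn nmax //.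
by apply/asboolP; exists q.
Qed.

Lemma beta_smallest (R : realType) (m k : nat) :
  (0 < m)%N -> (0 < k)%N ->
  hitting_bounds m k (beta R m k) /\ lbound (hitting_bounds m k) (beta R m k).
Proof.
move=> m0 k0.
have S1 : @hitting_bounds R m k 1.
  move=> X A /(_ (Ordinal m0)); rewrite mul1r ltr_nat.
  by rewrite ltnNge max_card.
have S0 : lbound (@hitting_bounds R m k) 0.
  move=> b Sb; rewrite leNgt; apply/negP => b0.
  have [i|Y [/(_ (Ordinal m0))[x _]]] := Sb unit (fun=> finset.set0).
    by rewrite cards0 card_unit mulr1.
  by rewrite finset.in_set0.
have hS : has_inf (@hitting_bounds R m k) by split; [exists 1 | exists 0].
split; last exact: ge_inf hS.2.
move=> X A hA.
have [X0|X0] := posnP #|X|.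
  have := max_card (A (Ordinal m0)); rewrite X0 leqn0 => /eqP A0.
  by move: (hA (Ordinal m0)); rewrite X0 A0 mulr0 ltxx.
pose M := [arg min_(i < Ordinal m0) #|A i|]%N.
have : beta R m k < #|A M|%:R / #|X|%:R by rewrite ltr_pdivlMr ?ltr0n.
case/(inf_lt hS.1) => b Sb; rewrite ltr_pdivlMr ?ltr0n // => hb.
apply: Sb => i; apply: (lt_le_trans hb); rewrite ler_nat /M.
by case: arg_minnP => // j _; apply.
Qed.

(* Main.v *)
(** For [1 - beta <= alpha], call a subfamily heavy if it has more than
    [beta |F|] members, and take the convex hull of the union of each heavy
    subfamily.  Any [d+1] heavy subfamilies have a hitting set of [k] members of
    [F]; a common point of these lies in all [d+1] hulls, so Helly's theorem
    gives a point [p] in every hull.  A closed halfspace missing a heavy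
    subfamily misses its hull, hence [p].

    For [alpha <= 1 - beta], let [A_0, ..., A_d] be subsets of [X] without a
    hitting set of size [k], and let [l_0, ..., l_d] be the barycentric
    coordinates of a simplex.  To [x] in [X] associate the flat where [l_i = 0]
    for every [i] such that [x] is in [A_i].  A set [Y] of at most [k] elements
    misses some [A_i], so the flats of [Y] share the [i]-th vertex.  Conversely
    any [p] has some [l_i p > 0], and the halfspace [l_i >= l_i p] meets only
    flats of elements outside [A_i]. *)
Require Import Defs.
From mathcomp Require Import all_boot all_order all_algebra reals.
From mathcomp Require Import boolp classical_sets interval_inference convex.
From mathcomp Require Import ring lra.

Set Implicit Arguments.
Unset Strict Implicit.
Unset Printing Implicit Defensive.

Import Order.TTheory GRing.Theory Num.Theory.
Local Open Scope classical_set_scope.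
Local Open Scope ring_scope.

(** * Convex combinations and the theorems of Radon and Helly *)

Section Convexity.
Context {R : realType} {d : nat}.
Implicit Types (C : set 'rV[R]_d).

Lemma convex_setE C : convex_set C <->
  forall (x y : 'rV[R]_d) (t : R), 0 <= t -> t <= 1 -> C x -> C y ->
    C (t *: x + (1 - t) *: y).
Proof.
split=> [cC x y t t0 t1 Cx Cy|cC x y t].
  by have := cC x y (Itv01 t0 t1); rewrite !inE => /(_ Cx Cy).
by rewrite !inE => Cx Cy; apply: cC.
Qed.

Lemma convex_set_comb C (I : finType) (P : pred I) (w : I -> R)
    (x : I -> 'rV[R]_d) :
  convex_set C -> (forall i, P i -> 0 < w i /\ C (x i)) ->
  0 < \sum_(i | P i) w i ->
  C ((\sum_(i | P i) w i)^-1 *: \sum_(i | P i) w i *: x i).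
Proof.
move=> /convex_setE cC hP.
(* Invariant of partial sums: nothing added yet, or a positive total weight whose normalised sum
   lies in [C]. *)
pose K (W : R) (V : 'rV[R]_d) := (W = 0 /\ V = 0) \/ (0 < W /\ C (W^-1 *: V)).
have : K (\sum_(i | P i) w i) (\sum_(i | P i) w i *: x i).
  apply: big_ind2 => [|W1 V1 W2 V2|i /hP[wi Ci]]; first by left.
    move=> [[-> ->]|[W10 C1]] [[-> ->]|[W20 C2]].
    - by left; rewrite !addr0.
    - by right; rewrite !add0r.
    - by right; rewrite !addr0.
    - right; split; first exact: addr_gt0.
      have W0 : 0 < W1 + W2 by exact: addr_gt0.
      have := cC _ _ (W1 / (W1 + W2)) _ _ C1 C2.
      rewrite !scalerA mulrAC mulfV ?gt_eqF // mul1r.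
      have -> : (1 - W1 / (W1 + W2)) / W2 = (W1 + W2)^-1.
        by field; rewrite !gt_eqF.
      rewrite -scalerDr; apply.
        by rewrite divr_ge0 // ltW.
      by rewrite ler_pdivrMr // mul1r lerDl ltW.
  by right; rewrite scalerA mulVf ?gt_eqF // scale1r.
by case=> [[-> _]|[]//]; rewrite ltxx.
Qed.

(** The rows [(1, x i)] live in dimension [d + 1 < n], so they are linearly dependent; the leading 1
    makes the coefficients sum to 0. *)
Lemma affine_dependence n (x : 'I_n -> 'rV[R]_d) : (d.+1 < n)%N ->
  exists a : 'I_n -> R,
    [/\ exists i, a i != 0, \sum_i a i = 0 & \sum_i a i *: x i = 0].
Proof.
move=> dn.
pose M : 'M[R]_(n, 1 + d) := \matrix_(i < n) row_mx 1%:M (x i).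
have /rowV0Pn[a /sub_kermxP aM a0] : kermx M != 0.
  rewrite kermx_eq0 /row_free; apply/negP => /eqP rM.
  by have := rank_leq_col M; rewrite rM leqNgt dn.
exists (a 0); split.
- by apply/existsP; apply: contraNT a0 => /existsPn a0; apply/eqP/rowP => i;
    rewrite mxE; apply/eqP; rewrite -[_ == _]negbK a0.
- move/rowP/(_ (lshift d 0)) : aM; rewrite !mxE => aM; rewrite -[RHS]aM.
  by apply: eq_bigr => i _; rewrite [M _ _]mxE row_mxEl mxE mulr1.
- apply/rowP => j; move/rowP/(_ (rshift 1 j)) : aM; rewrite !mxE => aM.
  rewrite -[RHS]aM summxE.
  by apply: eq_bigr => i _; rewrite [M _ _]mxE row_mxEr mxE.
Qed.

Lemma sum_pos_neg (V : zmodType) (I : finType) (a : I -> R) (f : I -> V) :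
  (forall i, a i = 0 -> f i = 0) -> \sum_i f i = 0 ->
  \sum_(i | 0 < a i) f i = \sum_(i | a i < 0) - f i.
Proof.
move=> f0 f_sum; apply/eqP; rewrite sumrN -subr_eq0 opprK -[X in _ == X]f_sum.
rewrite [X in _ == X](bigID (fun i => 0 < a i)) /=; apply/eqP; congr (_ + _).
rewrite [RHS](bigID (fun i => a i < 0)) /= [X in _ + X]big1 ?addr0.
  by apply: eq_bigl => i; case: ltgtP.
by move=> i /andP[]; case: ltgtP => // /esym /f0.
Qed.

(** The positive and the negative half of an affine dependence balance, both in weight and in
    weighted sum, so normalising either half gives the same point [r]. *)
Lemma radon n (x : 'I_n -> 'rV[R]_d) : (d.+1 < n)%N ->
  exists (P : {set 'I_n}) (r : 'rV[R]_d), forall C, convex_set C ->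
    ((forall i, i \in P -> C (x i)) -> C r) /\
    ((forall i, i \notin P -> C (x i)) -> C r).
Proof.
move=> /(affine_dependence x)[a [[i0 ai0] a_sum ax_sum]].
pose S := \sum_(i | 0 < a i) a i.
pose V := \sum_(i | 0 < a i) a i *: x i.
have SN : S = \sum_(i | a i < 0) - a i by exact: sum_pos_neg.
have VN : V = \sum_(i | a i < 0) - a i *: x i.
  under eq_bigr do rewrite scaleNr.
  by apply: sum_pos_neg => // i ->; rewrite scale0r.
(* If [S] vanished, so would all positive and, by [SN], all negative coefficients, against [ai0]. *)
have S0 : 0 < S.
  have S_ge0 : 0 <= S by apply: sumr_ge0 => i /ltW.
  rewrite lt_neqAle S_ge0 andbT eq_sym; apply: contra ai0 => S0.
  have [ai_gt0|ai_lt0|//] := ltgtP 0 (a i0).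
    by move: (ai_gt0); rewrite (psumr_eq0P _ (eqP S0)) ?ltxx // => i /ltW.
  move: S0; rewrite SN => /eqP S0; move: (ai_lt0); rewrite -oppr_gt0.
  by rewrite (psumr_eq0P _ S0) ?ltxx // => i; rewrite oppr_ge0 => /ltW.
exists [set i | 0 < a i]%SET, (S^-1 *: V) => C cC; split=> hC.
  by apply: convex_set_comb => // i ai; split=> //; apply: hC; rewrite inE.
move: S0; rewrite SN VN => S0.
apply: convex_set_comb => // i ai; rewrite oppr_gt0; split=> //.
by apply: hC; rewrite inE -leNgt ltW.
Qed.

Lemma helly (I : finType) (C : I -> set 'rV[R]_d) :
  (forall i, convex_set (C i)) -> k_intersecting d.+1 C ->
  \bigcap_i C i !=set0.
Proof.
move=> cC hC.
suff hJ n (J : {set I}) : (#|J| <= n)%N -> \bigcap_(i in [set` J]) C i !=set0.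
  have [p hp] := hJ _ [set: I]%SET (leqnn _).
  by exists p => i _; apply: hp; rewrite /= finset.in_setT.
elim: n J => [|n IHn] J Jn; first by apply: hC; rewrite (leq_trans Jn).
have [Jd|dJ] := leqP #|J| d.+1; first exact: hC.
(* [x i] lies in every member of [J] except possibly the [i]-th. In the Radon partition of these
   points, the side without the index of [j] lies in [C j], hence so does [r]. *)
have /choice[x hx] (i : 'I_#|J|) :
    exists y, forall j, j \in J -> j != enum_val i -> C j y.
  have [|y hy] := IHn (J :\ enum_val i)%SET.
    by move: Jn; rewrite (cardsD1 (enum_val i)) enum_valP.
  by exists y => j jJ ji; apply: hy; rewrite /= !finset.inE ji.
have [P [r hr]] := radon x dJ.
exists r => j /= jJ.
have [hP hNP] := hr _ (cC j).
have [i0 ji0] : exists i0 : 'I_#|J|, j = enum_val i0.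
  by exists (enum_rank_in jJ j); rewrite enum_rankK_in.
have hxi i : i != i0 -> C j (x i).
  by move=> ii0; apply: hx => //; rewrite ji0 (inj_eq enum_val_inj) eq_sym.
have [i0P|i0P] := boolP (i0 \in P); [apply: hNP|apply: hP] => i iP; apply: hxi.
  by apply: contraNneq iP => ->.
by apply: contraNneq i0P => <-.
Qed.

End Convexity.

(** * Convex hulls and the lower bound on [alpha] *)

Lemma convex_setC_halfspace (R : realType) d (H : set 'rV[R]_d) :
  closed_halfspace H -> convex_set (~` H).
Proof.
move=> [u [c [_ ->]]]; apply/convex_setE => x y t t0 t1 /= /negP + /negP.
rewrite -!ltNge => xc yc; apply/negP; rewrite -ltNge.
under eq_bigr do rewrite !mxE mulrDr !(mulrCA (u _ _)).
rewrite big_split /= -!mulr_sumr.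
set X := \sum_j _ in xc *; set Y := \sum_j _ in yc *.
have : Num.max X Y < c by rewrite gt_max xc.
apply: le_lt_trans; set m := Num.max X Y.
have -> : m = t * m + (1 - t) * m by ring.
by rewrite lerD // ler_wpM2l ?subr_ge0 // /m le_max lexx ?orbT.
Qed.

Definition convex_hull (R : realType) d (A : set 'rV[R]_d) : set 'rV[R]_d :=
  \bigcap_(C in [set C | convex_set C /\ A `<=` C]) C.

Lemma convex_convex_hull (R : realType) d (A : set 'rV[R]_d) :
  convex_set (convex_hull A).
Proof.
apply/convex_setE => x y t t0 t1 hx hy C [cC AC].
by move/convex_setE: (cC); apply => //; [apply: hx|apply: hy].
Qed.

Lemma depth_bounds_ge (R : realType) d k :
  (0 < d)%N ->
  hitting_bounds d.+1 k `<=` [set b : R | depth_bounds d k (1 - b)].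
Proof.
move=> d0 b hb I F cF kF.
pose heavy := [set J : {set I} | b * #|I|%:R < #|J|%:R :> R]%SET.
(* Light subfamilies get the whole space, so that Helly's theorem can be indexed by all of
   [{set I}]. *)
pose K (J : {set I}) : set 'rV[R]_d :=
  if J \in heavy then convex_hull (\bigcup_(i in [set` J]) F i) else setT.
have [J||p hp] := @helly R d {set I} K.
- rewrite /K; case: ifP => _; first exact: convex_convex_hull.
  by apply/convex_setE.
- move=> Js Jsd.
  have [->|[J0 J0s]] := finset.set_0Vmem Js.
    by exists 0 => J; rewrite /= finset.in_set0.
  pose Jh := (Js :&: heavy)%SET.
  have [Jh0|[J1 J1h]] := finset.set_0Vmem Jh.
    exists 0 => J /= JJs; rewrite /K; case: ifP => // Jheavy.
    by move: (finset.in_set0 J); rewrite -Jh0 finset.inE JJs Jheavy.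
  (* A hitting bound speaks of exactly [d.+1] sets: shorter lists are padded with [J1]. *)
  pose A (i : 'I_d.+1) := nth J1 (enum Jh) i.
  have Ah i : A i \in Jh.
    have [iJ|iJ] := ltnP i (size (enum Jh)); last by rewrite /A nth_default.
    by rewrite -mem_enum mem_nth.
  have [|Y [hY Yk]] := hb I A.
    by move=> i; have := Ah i; rewrite !finset.inE => /andP[].
  have [q hq] := kF Y Yk.
  exists q => J /= JJs; rewrite /K; case: ifP => // Jheavy.
  have JJh : J \in Jh by rewrite finset.inE JJs.
  have Ji : (index J (enum Jh) < d.+1)%N.
    apply: leq_trans Jsd; apply: (@leq_trans #|Jh|).
      by rewrite cardE index_mem mem_enum.
    by apply: subset_leq_card; exact: finset.subsetIl.
  have [i iY] := hY (Ordinal Ji); rewrite /A nth_index ?mem_enum // => iJ.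
  by move=> C [_]; apply; exists i => //; exact: hq.
- exists p; have [[H [hH Hp ->]] _] := dep_smallest F p d0.
  rewrite leNgt; apply/negP => lt_dep.
  (* Too small a depth makes the members missed by [H] a heavy subfamily; its hull lies in the
     complement of [H], yet contains [p]. *)
  have : K (~: hits F H)%SET p by exact: hp.
  rewrite /K; case: ifPn => [_ /(_ (~` H))|/negP[]].
    move=> /(_ _ Hp); apply; split; first exact: convex_setC_halfspace.
    move=> x [i /= + Fix] Hx; rewrite !finset.inE => /negP; apply.
    by apply/asboolP; exists x.
  rewrite finset.inE -(cardsC (hits F H)) natrD.
  move: lt_dep; rewrite -(cardsC (hits F H)) natrD; lra.
Qed.

(** * Barycentric coordinates and the upper bound on [alpha] *)

Section Barycentric.
Context {R : realType} {d : nat}.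

(** The simplex has the origin as vertex [ord0] and the standard basis vectors as the others. *)
Definition bary (i : 'I_d.+1) (p : 'rV[R]_d) : R :=
  if unlift ord0 i is Some j then p 0 j else 1 - \sum_j p 0 j.

Definition vertex (i : 'I_d.+1) : 'rV[R]_d :=
  if unlift ord0 i is Some j then delta_mx 0 j else 0.

Lemma sum_bary p : \sum_i bary i p = 1.
Proof.
rewrite big_ord_recl /bary unlift_none.
by rewrite [X in _ + X](eq_bigr (p 0)) ?subrK // => j _; rewrite liftK.
Qed.

Lemma bary_vertex i j : j != i -> bary j (vertex i) = 0.
Proof.
rewrite /bary /vertex.
case: (unliftP ord0 i) => [i' ->|->]; case: (unliftP ord0 j) => [j' ->|->] ji.
- by rewrite mxE eqxx /= (negbTE (contra_neq _ ji)) // => ->.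
- rewrite (bigD1 i') //= big1 => [|l li]; rewrite mxE !eqxx ?addr0 ?subrr //=.
  by rewrite (negbTE li).
- by rewrite mxE.
- by rewrite eqxx in ji.
Qed.

Lemma bary_conv i x y t :
  bary i (t *: x + (1 - t) *: y) = t * bary i x + (1 - t) * bary i y.
Proof.
rewrite /bary; case: unliftP => [j _|_]; first by rewrite !mxE.
under eq_bigr do rewrite !mxE.
by rewrite big_split /= -!mulr_sumr; ring.
Qed.

Lemma closed_halfspace_bary i c :
  (0 < d)%N -> closed_halfspace [set x | c <= bary i x].
Proof.
move=> d0; rewrite /bary; case: (unliftP ord0 i) => [j _|_].
  exists (delta_mx 0 j), c; split.
    by apply/eqP => /matrixP/(_ 0 j)/eqP; rewrite !mxE !eqxx oner_eq0.
  apply/seteqP; split=> x /=; rewrite (bigD1 j) //= big1;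
    by [rewrite !mxE !eqxx addr0 mul1r
       |move=> l lj; rewrite !mxE eqxx /= (negbTE lj) mul0r].
(* The coordinate at [ord0] is affine, not linear: its constant term 1 moves into the threshold. *)
exists (const_mx (-1)), (c - 1); split.
  apply/eqP => /matrixP/(_ 0 (Ordinal d0))/eqP.
  by rewrite !mxE oppr_eq0 oner_eq0.
have sE (x : 'rV[R]_d) :
    \sum_j (const_mx (-1) : 'rV[R]_d) 0 j * x 0 j = - \sum_j x 0 j.
  by rewrite -sumrN; apply: eq_bigr => j _; rewrite mxE mulN1r.
by apply/seteqP; split=> x /=; rewrite sE => h; lra.
Qed.

Lemma depth_bounds_le k (a b : R) :
  (0 < d)%N -> depth_bounds d k a -> ~ hitting_bounds d.+1 k b -> a + b < 1.
Proof.
move=> d0 ha /existsNP[X /existsNP[A /not_implyP[hA noY]]].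
pose F x : set 'rV[R]_d := [set p | forall i, x \in A i -> bary i p = 0].
have [x|J Jk|p] := ha X F.
- apply/convex_setE => y z t _ _ Fy Fz i xi.
  by rewrite bary_conv Fy // Fz // !mulr0 addr0.
- have /existsNP[i hi] : ~ hitting_set A J by move=> hJ; apply: noY; exists J.
  exists (vertex i) => x /= xJ j xj; apply: bary_vertex; apply/eqP => ji.
  by apply: hi; exists x; rewrite // -ji.
have [i pi] : exists i, 0 < bary i p.
  apply/existsP; apply: contraT => /existsPn p_le0.
  have : \sum_i bary i p <= 0 by apply: sumr_le0 => i _; rewrite leNgt.
  by rewrite sum_bary ler10.
pose H : set 'rV[R]_d := [set x | bary i p <= bary i x].
have hH : closed_halfspace H by exact: closed_halfspace_bary.
have dep_le : (dep F p <= #|~: A i|)%N.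
  have [_ /(_ H hH (lexx _))] := dep_smallest F p d0.
  move/leq_trans; apply; apply: subset_leq_card; apply/fintype.subsetP => x.
  rewrite !finset.inE => /asboolP[y [Fy Hy]]; apply/negP => xi.
  by move: Hy; rewrite /H /= Fy // leNgt pi.
move=> /le_trans/(_ (_ : _ <= #|~: A i|%:R)); rewrite ler_nat => /(_ dep_le).
have := hA i; have := cardsC (A i); have [->|X0] := posnP #|X|.
  by move/eqP; rewrite addn_eq0 => /andP[/eqP-> _]; rewrite mulr0 ltxx.
move=> <-; rewrite cardsC => bX aX.
(* After scaling by [#|X|]: [a * #|X|] is at most [#|X| - #|A i|], which is below
   [(1 - b) * #|X|]. *)
rewrite -(ltr_pM2r (_ : 0 < #|X|%:R)) ?ltr0n // mul1r.
by rewrite -[in ltRHS](cardsC (A i)) natrD; lra.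
Qed.

End Barycentric.

Theorem theorem4 (R : realType) (d k : nat) (hd : (0 < d)%N)
    (hk : (1 <= k <= d.+1)%N) :
  alpha R d k + beta R d.+1 k = 1.
Proof.
have [k0 _] := andP hk.
have [alphaP alpha_max] := @alpha_largest R d k hd k0.
have [betaP beta_min] := @beta_smallest R d.+1 k (ltn0Sn d) k0.
apply/eqP; rewrite eq_le; apply/andP; split; last first.
  by rewrite -lerBlDr; apply: alpha_max; exact: depth_bounds_ge.
rewrite leNgt; apply/negP => ab_gt1.
(* Here [1 - alpha] would lie below the least hitting bound. As [alpha] is itself a depth bound,
   [depth_bounds_le] then yields [1 < 1]. *)
have nb : ~ hitting_bounds d.+1 k (1 - alpha R d k).
  by move=> /beta_min; rewrite leNgt ltrBlDl ab_gt1.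
by have := depth_bounds_le hd alphaP nb; rewrite addrC subrK ltxx.
Qed.
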